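(* For $k,n\in\mathbb N_0$ let the sequence transformation $\mathcal T_k^{(n)}(s_n)$ be defined by $$\mathcal T_k^{(n)}(s_n)=\frac{\Delta^k[P_{k-1}(n)\,s_n/\Delta s_{n-1}]}{\Delta^k[P_{k-1}(n)/\Delta s_{n-1}]},$$ where for sufficiently large $k$, $P_{k-1}(n)$ is a polynomial of degree $\le k-1$ in $n$. Let $\{s_n\}$ be a sequence which converges to some limit $s$, which belongs to the domain of $\mathcal T_k^{(n)}$ (in particular, $P_{k-1}(n)/\Delta s_{n-1}$ is not annihilated by $\Delta^k$), and whose elements satisfy for all $n\in\mathbb N_0$ $$(s_n-s)/\Delta s_{n-1}=\gamma n+\delta,\qquad \gamma,\delta\in\mathbb R,\quad\gamma\neq0.$$ If for sufficiently large $k$ the degree of $P_{k-1}(n)$ is exactly $k-1$, then (for such $k$) $\mathcal T_k^{(n)}(s_n)$ does not accelerate the convergence of $\{s_n\}$. If for sufficiently large $k$ $P_{k-1}(n)$ is a polynomial of degree $\le k-2$ in $n$, then (for such $k$) $\mathcal T_k^{(n)}(s_n)$ is exact for $\{s_n\}$, i.e. $\mathcal T_k^{(n)}(s_n)=s$.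
   Context: All sequences are real. $\Delta f(n)=f(n+1)-f(n)$ is the forward difference, acting on $n$ only; $\Delta s_{n-1}=s_n-s_{n-1}$, with the convention $s_{-1}=0$. The sequence belongs to the domain of the transformation if $\Delta s_{n-1}\neq0$ and the denominator $\Delta^k[P_{k-1}(n)/\Delta s_{n-1}]$ is nonzero, so that all expressions are defined. A transformation accelerates the convergence of $\{s_n\}$ if $\lim_{n\to\infty}(\mathcal T_k^{(n)}(s_n)-s)/(s_n-s)=0$ (fixed $k$). *)

(* Defs.v *)
From HB Require Import structures.
From mathcomp Require Import all_boot all_order all_algebra.
From mathcomp Require Import all_classical all_reals all_analysis.
Set Implicit Arguments.
Unset Strict Implicit.
Unset Printing Implicit Defensive.
Import Order.TTheory GRing.Theory Num.Theory.
Import numFieldNormedType.Exports.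
Local Open Scope classical_set_scope.
Local Open Scope ring_scope.

(* [telescope] is the forward difference, (telescope f) n = f n.+1 - f n. *)
Definition fdiff (R : realType) (k : nat) (f : R^nat) : R^nat :=
  iter k (@telescope R) f.

(* Delta s_{n-1} = s_n - s_{n-1}, with the convention s_{-1} = 0. *)
Definition bdiff (R : realType) (s : R^nat) : R^nat :=
  fun n => s n - (if n is m.+1 then s m else 0).

(* Indices are shifted: P k n stands for P_{k-1}(n), so that the family is
   indexed by all natural numbers k. *)
Definition transform_num (R : realType) (P : nat -> R^nat) (k : nat)
    (s : R^nat) : R^nat :=
  fdiff k (fun n => P k n * s n / bdiff s n).

Definition transform_den (R : realType) (P : nat -> R^nat) (k : nat)
    (s : R^nat) : R^nat :=
  fdiff k (fun n => P k n / bdiff s n).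

Definition transform (R : realType) (P : nat -> R^nat) (k : nat)
    (s : R^nat) : R^nat :=
  fun n => transform_num P k s n / transform_den P k s n.

Definition in_domain (R : realType) (P : nat -> R^nat) (k : nat)
    (s : R^nat) : Prop :=
  (forall n, bdiff s n != 0) /\ (forall n, transform_den P k s n != 0).

(* The sequence t accelerates the convergence of s to l. *)
Definition accelerates (R : realType) (t s : R^nat) (l : R) : Prop :=
  (fun n => (t n - l) / (s n - l)) @ \oo --> (0 : R).

(* Main.v *)
Require Import Defs.
From HB Require Import structures.
From mathcomp Require Import all_boot all_order all_algebra.
From mathcomp Require Import all_classical all_reals all_analysis.
From mathcomp Require Import zify ring lra.
Set Implicit Arguments.
Unset Strict Implicit.
Unset Printing Implicit Defensive.
Import Order.TTheory GRing.Theory Num.Theory.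
Import numFieldNormedType.Exports.
Local Open Scope classical_set_scope.
Local Open Scope ring_scope.

(** Put [a n = gamma * n + delta], [b = bdiff s] and [u = b^-1], so that
    [s - l = a / u].  The hypothesis on [s] gives [transform - l =
    Delta^k [P a] / Delta^k [P u]], where [Delta^k [P a]] is the constant
    [k! * gamma * p_(k-1)], with [p_(k-1)] the coefficient of degree [k - 1]
    of [P]: this is exactness for smaller degree.  The hypothesis is also a
    first order recurrence for [u], by which [Delta^k [P u]] is
    [r * u / (a n * ... * a (n + k - 1))] for a polynomial [r] of degree at
    most [k - 1].  Hence [(s - l) * Delta^k [P u]] is bounded, and
    [(transform - l) / (s - l)] stays away from [0] if [p_(k-1)] is nonzero. *)

Definition diff_poly (R : comNzRingType) (p : {poly R}) : {poly R} :=
  p \Po ('X + 1%:P) - p.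

Lemma diff_poly_horner (R : comNzRingType) (p : {poly R}) (x : R) :
  (diff_poly p).[x] = p.[x + 1] - p.[x].
Proof. by rewrite /diff_poly hornerD hornerN horner_comp !hornerE. Qed.

(** A product rule for the difference, in the shape required by induction along Horner's scheme. *)
Lemma diff_poly_MXaddC (R : comNzRingType) (p : {poly R}) (c : R) :
  diff_poly (p * 'X + c%:P) = diff_poly p * 'X + (diff_poly p + p).
Proof.
rewrite /diff_poly comp_polyD comp_polyM comp_polyX comp_polyC subrK.
by rewrite mulrDr mulrBl polyC1 mulr1 opprD addrACA subrr addr0 addrAC.
Qed.

(** The difference of X^m is m X^(m-1) plus lower terms. For [m = 0] the truncated index [m.-1] is
    harmless, since the difference of a constant is 0. *)
Lemma diff_poly_size_coef (R : comNzRingType) (p : {poly R}) (m : nat) :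
  (size p <= m.+1)%N ->
  (size (diff_poly p) <= m)%N /\ (diff_poly p)`_m.-1 = m%:R * p`_m.
Proof.
elim/poly_ind: p m => [|p c IH] m hp.
  by rewrite /diff_poly comp_poly0 subrr coef0 size_poly0 coef0 mulr0.
case: m hp => [|m] hp.
  have -> : diff_poly (p * 'X + c%:P) = 0.
    by rewrite (size1_polyC hp) /diff_poly comp_polyC subrr.
  by rewrite size_poly0 coef0 mul0r.
have hpm : (size p <= m.+1)%N.
  apply/leq_sizeP => j hj.
  by have /leq_sizeP/(_ j.+1 hj) := hp; rewrite coefD coefMX coefC /= addr0.
have [sz cf] := IH _ hpm.
rewrite diff_poly_MXaddC; split.
  apply/leq_sizeP => j hj; rewrite coefD [X in _ + X]coefD coefMX.
  have -> : (j == 0)%N = false by case: j hj.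
  rewrite !(leq_sizeP _ _ sz) ?(leq_sizeP _ _ hpm) ?addr0 //; lia.
rewrite coefD coefMX [X in _ + X]coefD [in RHS]coefD coefMX coefC /= addr0 cf.
rewrite [in X in _ + X](leq_sizeP _ _ sz) // add0r.
rewrite -[in RHS]natr1 mulrDl mul1r.
by case: (m) => [|m'] //=; rewrite mul0r.
Qed.

Lemma size_mul_affine (R : comNzRingType) (c d : R) (p : {poly R}) (m : nat) :
  (size p <= m)%N -> (size (p * (c *: 'X + d%:P))%R <= m.+1)%N.
Proof.
move=> hp; apply/leq_sizeP => j hj.
rewrite mulrDr -scalerAr coefD coefZ coefMX coefMC.
case: j hj => // j hj /=.
by rewrite !(leq_sizeP _ _ hp) ?mulr0 ?mul0r ?addr0 //; exact: ltnW.
Qed.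

Lemma fdiffS (R : realType) (k : nat) (f : R^nat) (n : nat) :
  fdiff k.+1 f n = fdiff k f n.+1 - fdiff k f n.
Proof. by []. Qed.

Lemma fdiff_poly (R : realType) (k : nat) (p : {poly R}) (n : nat) :
  (size p <= k.+1)%N -> fdiff k (fun i => p.[i%:R]) n = k`!%:R * p`_k.
Proof.
elim: k p => [|k IH] p hp.
  by rewrite /fdiff /= (size1_polyC hp) hornerC coefC mul1r.
have [sz cf] := diff_poly_size_coef hp.
rewrite /fdiff iterSr.
have -> : telescope (fun i => p.[i%:R]) = (fun i => (diff_poly p).[i%:R]).
  by apply/funext => i; rewrite /telescope diff_poly_horner natr1.
by rewrite -/(fdiff _ _) IH // cf factS natrM mulrCA mulrA.
Qed.

Lemma fdiffDM (R : realType) (k : nat) (f g : R^nat) (c : R) (n : nat) :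
  fdiff k (fun i => c * f i + g i) n = c * fdiff k f n + fdiff k g n.
Proof.
elim: k n => [//|k IH] n.
by rewrite !fdiffS !IH; ring.
Qed.

Lemma fdiff_poly_hypergeometric (R : realType) (u : R^nat)
    (gamma delta : R) (N : nat) (p : {poly R}) (k : nat) :
  (forall n, (N <= n)%N -> gamma * n%:R + delta != 0) ->
  (forall n, (N <= n)%N ->
     (gamma * n%:R + delta) * u n.+1 = (gamma * n.+1%:R + delta - 1) * u n) ->
  exists r : {poly R}, (size r <= size p)%N /\
    forall n, (N <= n)%N -> fdiff k (fun i => p.[i%:R] * u i) n =
      r.[n%:R] * u n / \prod_(i < k) (gamma * (n + i)%:R + delta).
Proof.
move=> a0 hu; elim: k => [|k [r [szr hr]]].
  by exists p; split=> // n _; rewrite big_ord0 divr1.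
(* With a n = gamma * n + delta, the new numerator is r(n+1) (a(n+1) - 1) - r(n) a(n+k). Subtracting
   and adding r(n) (a(n+1) - 1) gives this form, in which the degree visibly does not grow: the
   difference loses the degree that the affine factor restores. *)
exists (diff_poly r * (gamma *: 'X + (gamma + delta - 1)%:P)
        + (gamma - 1 - gamma * k%:R) *: r); split.
  apply: leq_trans (size_polyD _ _) _; rewrite geq_max; apply/andP; split.
    case: (size p) szr => [|m] szr.
      move: szr; rewrite leqn0 size_poly_eq0 => /eqP ->.
      by rewrite /diff_poly comp_poly0 subrr mul0r size_poly0.
    have [sz _] := diff_poly_size_coef szr.
    exact: size_mul_affine.
  by apply: leq_trans (size_scale_leq _ _) szr.
move=> n hn; rewrite fdiffS !hr //; last exact: leqW.
have w0 j m : (N <= m)%N -> \prod_(i < j) (gamma * (m + i)%:R + delta) != 0.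
  by move=> hm; apply/prodf_neq0 => i _; apply: a0; exact: leq_trans (leq_addr _ _).
(* The longer product is a common denominator for the values at n+1 and n: the former lacks its
   first factor, the latter its last. *)
have E1 : \prod_(i < k.+1) (gamma * (n + i)%:R + delta) =
   (gamma * n%:R + delta) * \prod_(i < k) (gamma * (n.+1 + i)%:R + delta).
  rewrite big_ord_recl addn0; congr (_ * _); apply: eq_bigr => i _.
  by rewrite /= /bump /= addnCA add1n addSn.
have E2 : \prod_(i < k.+1) (gamma * (n + i)%:R + delta) =
   \prod_(i < k) (gamma * (n + i)%:R + delta) * (gamma * (n + k)%:R + delta).
  by rewrite big_ord_recr.
have -> : r.[n.+1%:R] * u n.+1 / \prod_(i < k) (gamma * (n.+1 + i)%:R + delta) =
  r.[n.+1%:R] * ((gamma * n.+1%:R + delta - 1) * u n) /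
    \prod_(i < k.+1) (gamma * (n + i)%:R + delta).
  rewrite -hu // E1; field.
  by rewrite !(a0, w0) // leqW.
have -> : r.[n%:R] * u n / \prod_(i < k) (gamma * (n + i)%:R + delta) =
  r.[n%:R] * (gamma * (n + k)%:R + delta) * u n /
    \prod_(i < k.+1) (gamma * (n + i)%:R + delta).
  have := a0 _ (leq_trans hn (leq_addr k n)); rewrite E2.
  by move: (_ + delta) => A A0; field; rewrite A0 w0.
rewrite -mulrBl; congr (_ / _).
rewrite hornerD hornerM diff_poly_horner !hornerE natr1 natrD -natr1 /=; ring.
Qed.

Lemma poly_nat_bound (R : realType) (p : {poly R}) (m : nat) :
  (size p <= m.+1)%N -> exists2 C : R, 0 <= C &
    forall n, (0 < n)%N -> `|p.[n%:R]| <= C * n%:R ^+ m.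
Proof.
move=> hp; exists (\sum_(i < m.+1) `|p`_i|); first exact: sumr_ge0.
move=> n n0; rewrite (horner_coef_wide _ hp) mulr_suml.
apply: le_trans (ler_norm_sum _ _ _) _; apply: ler_sum => i _.
rewrite normrM ler_wpM2l // ger0_norm ?exprn_ge0 //.
by rewrite ler_weXn2l ?ler1n // -ltnS.
Qed.

(** From [N] on, [|delta|] is at most half of [|gamma| * n]. The second index [m] gives all factors
    of the product starting at [n] the same lower bound. *)
Lemma affine_nat_lower_bound (R : realType) (gamma delta : R) :
  gamma != 0 -> exists2 N : nat, (0 < N)%N &
    forall n m, (N <= n)%N -> (n <= m)%N ->
      `|gamma| / 2 * n%:R <= `|gamma * m%:R + delta|.
Proof.
move=> g0; have g1 : 0 < `|gamma| by rewrite normr_gt0.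
exists (Num.bound (2 * `|delta| / `|gamma|)).+1 => // n m hn hm.
have hb : 2 * `|delta| / `|gamma| < n%:R.
  apply: lt_le_trans (archi_boundP _) _; first by rewrite divr_ge0 ?mulr_ge0.
  by rewrite ler_nat ltnW.
rewrite ltr_pdivrMr // in hb.
have h1 : `|gamma| * n%:R <= `|gamma| * m%:R by rewrite ler_pM2l // ler_nat.
have : `|gamma * m%:R| - `|delta| <= `|gamma * m%:R + delta|.
  by rewrite -[`|delta|]normrN -{2}[delta]opprK lerB_dist.
rewrite normrM (ger0_norm (ler0n _ _)); lra.
Qed.

Lemma transform_sub_limit (R : realType) (P : nat -> R^nat) (s : R^nat)
    (l gamma delta : R) (k : nat) (p : {poly R}) (n : nat) :
  (forall n, (s n - l) / bdiff s n = gamma * n%:R + delta) ->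
  (forall n, P k.+1 n = p.[n%:R]) -> (size p <= k.+1)%N ->
  transform_den P k.+1 s n != 0 ->
  transform P k.+1 s n - l =
    (k.+1)`!%:R * (gamma * p`_k) / transform_den P k.+1 s n.
Proof.
move=> hr hP hp den0; pose a : {poly R} := gamma *: 'X + delta%:P.
have sza : (size (p * a)%R <= k.+2)%N by exact: size_mul_affine.
have cfa : (p * a)`_k.+1 = gamma * p`_k.
  rewrite mulrDr -scalerAr coefD coefZ coefMX coefMC /=.
  by rewrite (leq_sizeP _ _ hp k.+1) // mul0r addr0.
have num : transform_num P k.+1 s n =
    l * transform_den P k.+1 s n + (k.+1)`!%:R * (gamma * p`_k).
  rewrite -cfa -(@fdiff_poly R _ _ n sza) -fdiffDM /transform_num.
  congr (fdiff _ _ _); apply/funext => i.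
  by rewrite hornerM !hornerE -hr hP /=; ring.
by rewrite /transform num; field.
Qed.

Lemma transform_den_error_bounded (R : realType) (P : nat -> R^nat) (s : R^nat)
    (l gamma delta : R) (k : nat) (p : {poly R}) :
  gamma != 0 -> (forall n, bdiff s n != 0) ->
  (forall n, (s n - l) / bdiff s n = gamma * n%:R + delta) ->
  (forall n, P k.+1 n = p.[n%:R]) -> (size p <= k.+1)%N ->
  exists N : nat, exists M : R, forall n, (N <= n)%N -> s n - l != 0 /\
    `|transform_den P k.+1 s n * (s n - l)| <= M.
Proof.
move=> g0 b0 hr hP hp; pose u n := (bdiff s n)^-1.
have [N N0 hN] := affine_nat_lower_bound delta g0.
have g2 : 0 < `|gamma| / 2 by rewrite divr_gt0 ?normr_gt0.
have a0 n : (N <= n)%N -> gamma * n%:R + delta != 0.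
  move=> hn; rewrite -normr_gt0; apply: lt_le_trans (hN n n hn (leqnn n)).
  by rewrite mulr_gt0 // ltr0n (leq_trans N0).
have e n : s n - l = (gamma * n%:R + delta) * bdiff s n.
  by rewrite -hr divfK.
(* Write a n = gamma * n + delta and b = [bdiff s]. Differencing s - l = a b gives b(n+1) = a(n+1)
   b(n+1) - a(n) b(n). Only b at successors is unfolded, so the convention for s_{-1} does not
   enter. *)
have hu n : (N <= n)%N -> (gamma * n%:R + delta) * u n.+1
    = (gamma * n.+1%:R + delta - 1) * u n.
  move=> _; have hb : bdiff s n.+1 = (s n.+1 - l) - (s n - l) by rewrite /bdiff; ring.
  have {hb} : (gamma * n%:R + delta) * bdiff s n =
      (gamma * n.+1%:R + delta - 1) * bdiff s n.+1.
    by rewrite mulrBl mul1r {2}hb !e; ring.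
  move=> h; have -> : gamma * n%:R + delta =
      (gamma * n.+1%:R + delta - 1) * bdiff s n.+1 / bdiff s n by rewrite -h mulfK.
  by rewrite /u; field; rewrite !b0.
have [r [szr hden]] := @fdiff_poly_hypergeometric R u gamma delta N p k.+1 a0 hu.
have sza := size_mul_affine gamma delta (leq_trans szr hp).
have [C C0 hC] := poly_nat_bound sza.
(* The factor [bdiff s n] of [s n - l] cancels [u n]. What remains is a polynomial of degree at most
   k+1, bounded by C n^(k+1), over k+1 factors of size at least [|gamma| / 2 * n]. *)
exists N, (C / (`|gamma| / 2) ^+ k.+1) => n hn; split.
  by rewrite e mulf_neq0 // a0.
have -> : transform_den P k.+1 s n = fdiff k.+1 (fun i => p.[i%:R] * u i) n.
  by congr (fdiff _ _ _); apply/funext => i; rewrite hP.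
have n0 : 0 < n%:R :> R by rewrite ltr0n (leq_trans N0).
have w_ge : (`|gamma| / 2 * n%:R) ^+ k.+1 <=
    `|\prod_(i < k.+1) (gamma * (n + i)%:R + delta)|.
  rewrite normr_prod -[X in _ ^+ X]card_ord -prodr_const.
  apply: ler_prod => i _; rewrite hN ?leq_addr // andbT.
  by rewrite mulr_ge0 // ltW.
have -> : fdiff k.+1 (fun i => p.[i%:R] * u i) n * (s n - l) =
  (r * (gamma *: 'X + delta%:P)).[n%:R]
     / \prod_(i < k.+1) (gamma * (n + i)%:R + delta).
  rewrite hden // e hornerM !hornerE /u.
  by move: ((\prod_(_ < _) _)^-1) => w /=; field.
have wpos : 0 < (`|gamma| / 2 * n%:R) ^+ k.+1 by rewrite exprn_gt0 // mulr_gt0.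
rewrite normrM normfV ler_pdivrMr; last exact: lt_le_trans wpos w_ge.
apply: le_trans (hC n _) _; first by rewrite -(ltr0n R).
have -> : C * n%:R ^+ k.+1 = C / (`|gamma| / 2) ^+ k.+1 * (`|gamma| / 2 * n%:R) ^+ k.+1.
  by rewrite [(_ * n%:R) ^+ _]exprMn mulrA divfK // expf_neq0 // gt_eqF.
by rewrite ler_wpM2l // divr_ge0 // exprn_ge0 // ltW.
Qed.

(* size p is the degree plus one: size p <= k, size p = k and size p < k mean
   degree <= k - 1, degree = k - 1 and degree <= k - 2 respectively. *)
Theorem mainTheorem5 (R : realType) (P : nat -> R^nat) (s : R^nat)
    (l gamma delta : R)
    (hP : exists K : nat, forall k : nat, (K <= k)%N ->
       exists p : {poly R}, (size p <= k)%N /\ forall n : nat, P k n = p.[n%:R])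
    (hs : s @ \oo --> l)
    (hgamma : gamma != 0)
    (hratio : forall n : nat, (s n - l) / bdiff s n = gamma * n%:R + delta) :
  (forall K : nat,
     (forall k : nat, (K <= k)%N ->
        exists p : {poly R}, size p = k /\ forall n : nat, P k n = p.[n%:R]) ->
     forall k : nat, (K <= k)%N -> in_domain P k s ->
       ~ accelerates (transform P k s) s l) /\
  (forall K : nat,
     (forall k : nat, (K <= k)%N ->
        exists p : {poly R}, (size p < k)%N /\ forall n : nat, P k n = p.[n%:R]) ->
     forall k : nat, (K <= k)%N -> in_domain P k s ->
       forall n : nat, transform P k s n = l).
Proof.
split=> K hK k /hK [p [hp hPk]] [b0 den0].
- case: k hp hPk den0 => [|k] hp hPk den0.
    (* For [k = 0] the polynomial is 0 and so is the denominator, against [in_domain]. *)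
    move: (den0 0%N); rewrite /transform_den /fdiff /= hPk.
    by move/eqP: hp; rewrite size_poly_eq0 => /eqP ->; rewrite horner0 mul0r eqxx.
  have szp : (size p <= k.+1)%N by rewrite hp.
  have [N [M hM]] := transform_den_error_bounded hgamma b0 hratio hPk szp.
  pose c := (k.+1)`!%:R * (gamma * p`_k).
  have c0 : c != 0.
    have pk : p`_k = lead_coef p by rewrite lead_coefE hp.
    rewrite !mulf_neq0 ?pnatr_eq0 -?lt0n ?fact_gt0 // pk lead_coef_eq0.
    by rewrite -size_poly_eq0 hp.
  have M0 : 0 < M.
    have [e0] := hM N (leqnn N); apply: lt_le_trans.
    by rewrite normr_gt0 mulf_neq0.
  (* The error ratio is c divided by the quantity that [M] bounds, so from [N] on its absolute value
     is at least [|c| / M]; this is the epsilon that refutes convergence to 0. *)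
  have cM : 0 < `|c| / M by rewrite divr_gt0 ?normr_gt0.
  move=> /cvgrPdist_lt /(_ _ cM) [N' _ hN'].
  pose n := maxn N N'.
  have [e0 le_M] := hM n (leq_maxl _ _).
  have := hN' n (leq_maxr _ _).
  rewrite /= sub0r normrN (transform_sub_limit hratio hPk szp) //.
  rewrite -/c -mulrA -invfM normrM normfV ltNge => /negP; apply.
  by rewrite ler_pM2l ?normr_gt0 // lef_pV2 // posrE normr_gt0 mulf_neq0.
(* The case [k = 0] contradicts [size p < k]; otherwise the coefficient in the error formula lies
   beyond the size of p and vanishes. *)
- case: k hp hPk den0 => // k hp hPk den0 n; apply/eqP; rewrite -subr_eq0.
  rewrite (transform_sub_limit hratio hPk (ltnW hp)) //.
  by rewrite (leq_sizeP _ _ hp) // !mulr0 mul0r.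
Qed.
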